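(* Let $h$ be the algebraic function of third order defined by $$h^3-3\,\frac{P_2(z)}{\Pi_4(z)}\,h+2\,\frac{P_1(z)}{\Pi_4(z)}=0,$$ where $$\Pi_4(x)=\prod_{j=1}^2(x-a_j)(x-b_j)=x^4-s_1x^3+s_2x^2-s_3x+s_4,\qquad P_1(z)=z-c,\qquad P_2(z)=z^2-\frac{s_1+2c}{3}\,z+d,$$ with $a_1,b_1,a_2,b_2,c,d\in\mathbb{C}$, and let $\mathfrak{R}$ be its Riemann surface. Define on $\mathfrak{R}$ the meromorphic functions $$R=z-\frac1h,\qquad \Delta=\frac{2K_2(R)}{h}+\Pi_4'(R),\qquad\text{where } K_2(x)=3x^2+2(c-s_1)x-3d+s_2 .$$ Then the Abelian integral of $h\,dz$ on $\mathfrak{R}$ is expressed in the variables $(R,\Delta)$ by $$\int h\,dz=-\int\frac{\Delta\,dR}{2\,\Pi_4(R)}-\frac12\ln\Pi_4(R)-\ln h .$$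
   Context: $\Pi_4'$ denotes the derivative of $\Pi_4$ with respect to its variable. An algebraic function $h$ of third order satisfies, by convention, an irreducible cubic equation over the rational functions of $z$; its Riemann surface $\mathfrak{R}$ is the compact three-sheeted branched covering of $\overline{\mathbb{C}}$ (the $z$-sphere) on which $h$ is a single-valued meromorphic function. The integrals are indefinite (multivalued) Abelian integrals on $\mathfrak{R}$, so the identity is understood up to an additive constant, i.e. as equality of the differentials of both sides on $\mathfrak{R}$. *)

(* Defs.v *)
From HB Require Import structures.
From mathcomp Require Import all_boot all_order all_algebra.
From mathcomp Require Import fraction complex.
From mathcomp Require Import all_classical all_reals all_analysis.

Set Implicit Arguments.
Unset Strict Implicit.
Unset Printing Implicit Defensive.

Import Order.TTheory GRing.Theory Num.Theory.
Import numFieldNormedType.Exports.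

Local Open Scope classical_set_scope.
Local Open Scope ring_scope.

(* Packed as a [numClosedFieldType] so that [R[i]] receives the topology and
   the normed-module structure given by its modulus; [derivable _ _ 1] and
   [derive1] are then complex differentiability and the complex derivative. *)
Definition Cplx (R : realType) : numClosedFieldType := R[i]%C.

(* The definitions below are written for any [numClosedFieldType] K with its
   norm topology; K is always [Cplx R] in use. *)

(** ** Riemann surfaces *)

(* Only the values of [coord] on [cdom] and of [param] on [cimg] matter. *)
Record chart (K : numClosedFieldType) (X : topologicalType) := Chart {
  cdom : set X;
  coord : X -> K;
  param : K -> X }.

Definition cimg (K : numClosedFieldType) (X : topologicalType) (phi : chart K X) :
  set K := coord phi @` cdom phi.

Definition is_chart (K : numClosedFieldType) (X : topologicalType) (phi : chart K X) :
    Prop :=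
  [/\ open (cdom phi), open (cimg phi),
      forall x, cdom phi x -> param phi (coord phi x) = x,
      forall x, cdom phi x -> {for x, continuous (coord phi)} &
      forall t, cimg phi t -> {for t, continuous (param phi)}].

Record compact_riemann_surface (K : numClosedFieldType) (X : topologicalType) := CRS {
  atlas : set (chart K X);
  atlas_chart : forall phi, atlas phi -> is_chart phi;
  atlas_cover : forall x : X, exists2 phi, atlas phi & cdom phi x;
  atlas_holomorphic : forall phi psi, atlas phi -> atlas psi ->
    forall x, cdom phi x -> cdom psi x ->
      derivable (coord psi \o param phi) (coord phi x) 1;
  crs_hausdorff : hausdorff_space X;
  crs_connected : connected [set: X];
  crs_compact : compact [set: X] }.

(** ** Maps to the Riemann sphere and branched coverings *)

Definition sphere (K : numClosedFieldType) : topologicalType :=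
  one_point_compactification K.

(* The affine coordinate [w] of the sphere, with the junk value 0 at infinity. *)
Definition affine (K : numClosedFieldType) (w : sphere K) : K :=
  if w is Some v then v else 0.

(* A holomorphic coordinate of the sphere near [w0]: [w] if [w0] is finite, and
   [1/w] if [w0] is infinity. As [0^-1 = 0], the latter sends infinity to 0. *)
Definition sphere_coord (K : numClosedFieldType) (w0 w : sphere K) : K :=
  if w0 is Some _ then affine w else (affine w)^-1.

Definition holomorphic_to_sphere (K : numClosedFieldType) (X : topologicalType)
    (S : compact_riemann_surface K X) (f : X -> sphere K) : Prop :=
  continuous f /\
  forall phi, atlas S phi -> forall x, cdom phi x ->
    derivable (sphere_coord (f x) \o f \o param phi) (coord phi x) 1.

(* [f] maps each of the [n] disjoint open sets [U i] making up the preimage of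
   [V] homeomorphically onto [V], with inverse [g i]. *)
Definition evenly_covered (X Y : topologicalType) (n : nat) (f : X -> Y)
    (V : set Y) : Prop :=
  exists (U : 'I_n -> set X) (g : 'I_n -> Y -> X),
  [/\ forall i, open (U i),
      f @^-1` V = \bigcup_i U i,
      trivIset [set: 'I_n] U &
      forall i, [/\ forall y, V y -> U i (g i y) /\ f (g i y) = y,
                    forall x, U i x -> g i (f x) = x &
                    forall y, V y -> {for y, continuous (g i)}]].

Definition branched_covering (X Y : topologicalType) (n : nat) (f : X -> Y) :
    Prop :=
  continuous f /\
  exists B : set Y,
    [/\ finite_set B, finite_set (f @^-1` B) &
        forall y, ~ B y ->
          exists V, [/\ open V, V y & evenly_covered n f V]].

(** ** Meromorphic functions and differentials *)

(* Meromorphic functions on a compact surface are represented by total functions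
   with arbitrary values at the (finitely many) poles. Accordingly, identities
   between meromorphic functions or differentials are required to hold at all
   but finitely many points. *)
Definition meromorphic (K : numClosedFieldType) (X : topologicalType)
    (S : compact_riemann_surface K X) (f : X -> K) : Prop :=
  forall phi, atlas S phi -> forall x, cdom phi x ->
    exists (n : nat) (g : K -> K),
      (\forall t \near coord phi x, derivable g t 1) /\
      (\forall t \near (coord phi x)^',
         f (param phi t) = g t / (t - coord phi x) ^+ n).

Definition almost_all (X : Type) (P : X -> Prop) : Prop :=
  finite_set [set x | ~ P x].

(* A differential is given by its coefficients [w phi x]: at the point [x] it is
   [w phi x * dt] in the coordinate [t] of the chart [phi]. *)
Definition form (K : numClosedFieldType) (X : topologicalType) : Type :=
  chart K X -> X -> K.

Definition dform (K : numClosedFieldType) (X : topologicalType) (f : X -> K) :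
  form K X := fun phi x => derive1 (f \o param phi) (coord phi x).

Definition form_scale (K : numClosedFieldType) (X : topologicalType) (f : X -> K)
  (w : form K X) : form K X := fun phi x => f x * w phi x.

Definition form_sub (K : numClosedFieldType) (X : topologicalType) (w1 w2 : form K X) :
  form K X := fun phi x => w1 phi x - w2 phi x.

Definition form_opp (K : numClosedFieldType) (X : topologicalType) (w : form K X) :
  form K X := fun phi x => - w phi x.

Definition dln (K : numClosedFieldType) (X : topologicalType) (f : X -> K) :
  form K X := form_scale (fun x => (f x)^-1) (dform f).

Definition form_eq (K : numClosedFieldType) (X : topologicalType)
    (S : compact_riemann_surface K X) (w1 w2 : form K X) : Prop :=
  almost_all (fun x => forall phi, atlas S phi -> cdom phi x ->
    w1 phi x = w2 phi x).

(** ** The cubic equation *)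

Definition Pi4 (K : numClosedFieldType) (a b : 'I_2 -> K) : {poly K} :=
  \prod_(j < 2) (('X - (a j)%:P) * ('X - (b j)%:P)).

Definition P1 (K : numClosedFieldType) (c : K) : {poly K} := 'X - c%:P.

Definition P2 (K : numClosedFieldType) (s1 c d : K) : {poly K} :=
  'X^2 - ((s1 + 2 * c) / 3) *: 'X + d%:P.

Definition K2 (K : numClosedFieldType) (s1 s2 c d : K) : {poly K} :=
  3 *: 'X^2 + (2 * (c - s1)) *: 'X + (- 3 * d + s2)%:P.

(* The polynomial [H^3 - 3 (p2/q) H + 2 (p1/q)] in [H] over the field of
   rational functions. *)
Definition cubic (K : numClosedFieldType) (q p1 p2 : {poly K}) :
    {poly {fraction {poly K}}} :=
  'X^3 - (3 * (tofrac p2 / tofrac q)) *: 'X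
    + (2 * (tofrac p1 / tofrac q))%:P.

(* Main.v *)
Require Import Defs.
From HB Require Import structures.
From mathcomp Require Import all_boot all_order all_algebra.
From mathcomp Require Import fraction complex.
From mathcomp Require finmap.
From mathcomp Require Import ring.
From mathcomp Require Import all_classical all_reals all_analysis.
Import Order.TTheory GRing.Theory Num.Theory.
Import numFieldNormedType.Exports.
Local Open Scope classical_set_scope.
Local Open Scope ring_scope.

(** Put u = 1/h and r = z - u.  Multiplying the cubic equation by Pi4(z) u^3
    gives Pi4(z) - 3 P2(z) u^2 + 2 P1(z) u^3 = 0.  When z = r + u is
    substituted and the left side expanded in powers of u with coefficients
    polynomial in r, the special form of P1 and P2 cancels the terms in u^4
    and u^3, and what remains is quadratic in u
    ([taylor_numerator], [cubic_quadratic]):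
<<
      K2(r) u^2 + Pi4'(r) u + Pi4(r) = 0.
>>
    So Delta = 2 K2(r) u + Pi4'(r) is a square root of the discriminant of
    this quadratic equation.  As dz = dr + du and d(ln h) = - du/u, one has
    h dz = dr/u - d(ln h), and the quadratic equation, solved for 1/u, reads
<<
      1/u = - (K2(r) u + Pi4'(r)) / Pi4(r) = - (Delta + Pi4'(r)) / (2 Pi4(r)).
>>
    This is the asserted identity ([differential_of_conic]).  It only uses
    the derivatives of z and h at the point and the equation at that point,
    so it remains to see that exceptions are finite in number.

    - The fibres of z are finite ([branched_covering_finite_fiber]), so a
      finite set of values of z may be discarded.  This makes h nonzero,
      since h = 0 forces P1(z) = 0 or Pi4(z) = 0.
    - If Pi4(r) = 0, then r is a root e of Pi4, and K2(e) u + Pi4'(e) = 0.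
      This determines u and hence z = e + u, unless K2(e) = Pi4'(e) = 0; but
      then 1/(z - e) would be a root of the cubic equation in the field of
      rational functions, against irreducibility
      ([K2_deriv_not_both_zero]).
    - The derivative of h exists except at isolated points, because h is
      meromorphic, and isolated exceptions on a compact surface are finite
      in number ([meromorphic_derivable], [compact_almost_all]). *)

Set Implicit Arguments.
Unset Strict Implicit.

(** * The quadratic equation behind the cubic one *)

Section Quadratic.
Context {K : numClosedFieldType} (q : {poly K}) (s1 s2 s3 s4 c d : K)
  (qE : q = 'X^4 - s1 *: 'X^3 + s2 *: 'X^2 - s3 *: 'X + s4%:P).

(** The coefficient of ['X - e] to the power 4 on the left is 1 - 3 + 2, and
    the linear coefficient of [P2] is the one that also cancels the power 3.
    Having the identity between polynomials, not only between their values,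
    is what makes the irreducibility of the cubic applicable. *)
Lemma taylor_numerator (e : K) :
  q - 3 * P2 s1 c d * ('X - e%:P) ^+ 2 + 2 * P1 c * ('X - e%:P) ^+ 3 =
  (K2 s1 s2 c d).[e]%:P * ('X - e%:P) ^+ 2
    + (q^`()).[e]%:P * ('X - e%:P) + q.[e]%:P.
Proof.
(* With m in place of s1 no division is left for [ring] to handle. *)
have [m s1E] : exists m, s1 = 3 * m - 2 * c.
  by exists ((s1 + 2 * c) / 3); field.
have -> : P2 s1 c d = 'X^2 - m%:P * 'X + d%:P.
  by rewrite /P2 s1E mul_polyC; congr (_ - _ *: _ + _); field.
rewrite /K2 /P1 qE s1E -!mul_polyC.
rewrite !(poly.derivE, hornerE) /=.
ring.
Qed.

Lemma cubic_quadratic (e u : K) :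
  q.[e + u] - 3 * (P2 s1 c d).[e + u] * u ^+ 2 + 2 * (P1 c).[e + u] * u ^+ 3 =
  (K2 s1 s2 c d).[e] * u ^+ 2 + (q^`()).[e] * u + q.[e].
Proof.
have /(congr1 (fun p => p.[e + u])) := taylor_numerator e.
have ue : e + u - e = u by rewrite addrAC subrr add0r.
rewrite !(hornerE, horner_exp) /= !ue => /eqP; rewrite -subr_eq0 => /eqP E.
by apply: subr0_eq; rewrite -[RHS]E; ring.
Qed.
End Quadratic.

(** * Roots of the cubic over the rational functions *)

Lemma irreducible_no_root (F : fieldType) (p : {poly F}) (v : F) :
  irreducible_poly p -> root p v -> size p = 2.
Proof.
move=> irr rpv; have := irr.2 ('X - v%:P).
rewrite size_XsubC dvdp_XsubCl rpv => /(_ isT isT) /eqp_size.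
by rewrite size_XsubC => ->.
Qed.

Lemma cubic_irreducible_no_root (K : numClosedFieldType) (q p1 p2 : {poly K})
    (v : {fraction {poly K}}) :
  irreducible_poly (cubic q p1 p2) -> ~~ root (cubic q p1 p2) v.
Proof.
move=> irr; apply/negP => /(irreducible_no_root irr) sz.
have : (cubic q p1 p2)`_3 = 0 by rewrite nth_default ?sz.
rewrite /cubic !(coefD, coefN, coefZ, coefXn, coefX, coefC) /= mulr0 subr0 addr0.
by move/eqP; rewrite oner_eq0.
Qed.

Lemma root_depressed_cubic_inv (F : fieldType) (q p1 p2 w : F) :
  q != 0 -> w != 0 -> q - 3 * p2 * w ^+ 2 + 2 * p1 * w ^+ 3 = 0 ->
  root ('X^3 - (3 * (p2 / q)) *: 'X + (2 * (p1 / q))%:P) w^-1.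
Proof.
move=> q0 w0 E.
rewrite rootE !(hornerD, hornerN, hornerZ, hornerXn, hornerX, hornerC).
apply/eqP; transitivity ((q - 3 * p2 * w ^+ 2 + 2 * p1 * w ^+ 3) / (q * w ^+ 3)).
  by field; rewrite q0 w0.
by rewrite E mul0r.
Qed.

Lemma root_cubic_inv (K : numClosedFieldType) (q p1 p2 w : {poly K}) :
  q != 0 -> w != 0 -> q - 3 * p2 * w ^+ 2 + 2 * p1 * w ^+ 3 = 0 ->
  root (cubic q p1 p2) (tofrac w)^-1.
Proof.
move=> q0 w0 E; apply: root_depressed_cubic_inv; rewrite ?tofrac_eq0 //.
by rewrite -[RHS](rmorph0 (@tofrac {poly K})) -E; ring.
Qed.

(** Were both to vanish, the Taylor expansion at the root [e] would be zero and
    the cubic would have the rational root 1/(z - e). *)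
Lemma K2_deriv_not_both_zero (K : numClosedFieldType) (q : {poly K})
    (s1 s2 s3 s4 c d e : K) :
  q = 'X^4 - s1 *: 'X^3 + s2 *: 'X^2 - s3 *: 'X + s4%:P ->
  q != 0 ->
  irreducible_poly (cubic q (P1 c) (P2 s1 c d)) ->
  root q e -> (K2 s1 s2 c d).[e] = 0 -> (q^`()).[e] != 0.
Proof.
move=> qE q0 irr /rootP qe Ke; apply/eqP => de.
have := taylor_numerator c d qE e; rewrite Ke de qe !mul0r !addr0.
move=> /(root_cubic_inv q0 (negbT (polyXsubC_eq0 e))).
exact/negP/cubic_irreducible_no_root.
Qed.

(** * Finite exceptional sets *)

Lemma almost_all_mono (X : Type) (P Q : X -> Prop) :
  (forall x, P x -> Q x) -> almost_all P -> almost_all Q.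
Proof. by move=> PQ; apply: sub_finite_set => x nQ /PQ. Qed.

Lemma almost_all_and (X : Type) (P Q : X -> Prop) :
  almost_all P -> almost_all Q -> almost_all (fun x => P x /\ Q x).
Proof.
move=> fP fQ.
apply: (@sub_finite_set _ _ ([set x | ~ P x] `|` [set x | ~ Q x])).
  by move=> x /= /not_andP.
by rewrite finite_setU.
Qed.

(** If the exceptions were infinite in number, the sets containing all but
    finitely many of them would form a proper filter, and a cluster point of
    it would have exceptions other than itself in each of its
    neighbourhoods. *)
Lemma compact_almost_all (X : topologicalType) (P : X -> Prop) :
  compact [set: X] -> (forall x, \forall y \near x^', P y) -> almost_all P.
Proof.
move=> cX nP; apply: contrapT => infB.
pose B := [set x | ~ P x].
pose F : set_system X := fun W => finite_set (B `\` W).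
have FF : ProperFilter F.
  apply: Build_ProperFilter_ex.
    move=> W FW; apply: contrapT => W0; apply: infB.
    apply: sub_finite_set FW => x Bx; split => // Wx; apply: W0.
    by exists x.
  split.
  - by rewrite /F setDT.
  - move=> U V FU FV; by rewrite /F setDIr finite_setU.
  - move=> U V UV; apply: sub_finite_set; exact: setDS.
have FT : F setT by rewrite /F setDT; exact: finite_set0.
have [x [_ clx]] := cX F FF FT.
have FB : F (B `\ x).
  apply: sub_finite_set (finite_set1 x) => y [By nBy].
  by apply: contrapT => yx; apply: nBy.
have [y [[By /eqP yx] /(_ yx)]] := clx _ _ FB (nP x).
exact: By.
Qed.

Lemma finite_root_set (K : idomainType) (q : {poly K}) :
  q != 0 -> finite_set [set z | root q z].
Proof.
move=> q0; apply: contrapT => /(infinite_set_fset (size q)) [A Aq].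
apply/negP; rewrite -ltnNge; apply: max_poly_roots => //.
  by apply/allP => z /Aq.
exact: finmap.fset_uniq.
Qed.

(** Over an evenly covered neighbourhood each sheet contributes one point. *)
Lemma branched_covering_finite_fiber (X Y : topologicalType) (n : nat)
    (f : X -> Y) (y : Y) :
  branched_covering n f -> finite_set (f @^-1` [set y]).
Proof.
move=> [_ [B [_ fB ev]]].
have [By|nBy] := pselect (B y).
  by apply: sub_finite_set fB => x /= ->.
have [V [_ Vy [U [g [_ UV _ gP]]]]] := ev y nBy.
apply: sub_finite_set (finite_image (g^~ y) (finite_finset (X := [set: 'I_n]))).
move=> x /= fx; have : (f @^-1` V) x by rewrite /= fx.
rewrite UV => -[i _ Ui]; exists i => //=.
by have [_ gK _] := gP i; rewrite -fx gK.
Qed.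

Lemma branched_covering_almost_all (X Y : topologicalType) (n : nat)
    (f : X -> Y) (P : Y -> Prop) :
  branched_covering n f -> almost_all P -> almost_all (P \o f).
Proof.
move=> bf fP.
have fF : finite_set (\bigcup_(y in [set y | ~ P y]) f @^-1` [set y]).
  by apply: bigcup_finite => // y _; exact: branched_covering_finite_fiber bf.
by apply: sub_finite_set fF => x nPx; exists (f x).
Qed.

Lemma almost_all_sphere (K : numClosedFieldType) (P : K -> Prop) :
  almost_all P ->
  almost_all (fun w : sphere K => exists2 z, w = Some z & P z).
Proof.
move=> fP.
have : finite_set ([set None : sphere K] `|` Some @` [set z | ~ P z]).
  by rewrite finite_setU; split => //; exact: finite_image.
apply: sub_finite_set => -[z|] /= nP; last by left.
by right; exists z => // Pz; apply: nP; exists z.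
Qed.

(** * Differentiability of meromorphic functions *)

Lemma near_join_dnbhs (T : topologicalType) (x : T) (P : T -> Prop) :
  hausdorff_space T -> (\forall y \near x^', P y) ->
  \forall y \near x^', \forall z \near y, P z.
Proof.
move=> hT nP; have := near_join nP => nnP.
near=> y.
have ny : \forall z \near y, z != x -> P z by near: y; exact: nbhs_dnbhs nnP.
have yx : y != x by near: y; exact: nbhs_dnbhs_neq.
have nx : \forall z \near y, z != x.
  have /open_nbhs_nbhs : open_nbhs y (~` [set x]).
    split; last exact/eqP.
    exact/closed_openC/accessible_closed_set1/hausdorff_accessible.
  by apply: filterS => z /eqP.
by near=> z; apply: (near ny z) => //; near: z.
Unshelve. all: by end_near. Qed.

Section Charts.
Context {K : numClosedFieldType} {X : topologicalType}
  (S : compact_riemann_surface K X).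
Local Notation coord := Defs.coord.

(** Near the point, [f] read in [psi] is [f] read in [phi] composed with the
    holomorphic transition map. *)
Lemma derivable_change_chart (f : X -> K) (phi psi : chart K X) (x : X) :
  atlas S phi -> atlas S psi -> cdom phi x -> cdom psi x ->
  derivable (f \o param phi) (coord phi x) 1 ->
  derivable (f \o param psi) (coord psi x) 1.
Proof.
move=> Aphi Apsi phix psix df.
have [ophi _ phiK _ _] := atlas_chart Aphi.
have [opsi oi psiK _ cpsi] := atlas_chart Apsi.
have ix : cimg psi (coord psi x) by exists x.
have ndom : \forall s \near coord psi x, cdom phi (param psi s).
  apply: (cpsi _ ix); rewrite psiK //; exact: open_nbhs_nbhs.
apply: (@near_eq_derivable _ _ _
  ((f \o param phi) \o (coord phi \o param psi))).
  by near=> s => /=; rewrite phiK //; near: s.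
apply/derivable1_diffP/differentiable_comp.
  exact/derivable1_diffP/(atlas_holomorphic Apsi Aphi psix phix).
by rewrite /= psiK //; apply/derivable1_diffP.
Unshelve. all: by end_near. Qed.

Lemma chart_dnbhs (phi : chart K X) (x : X) (P : K -> Prop) :
  is_chart phi -> cdom phi x ->
  (\forall t \near (coord phi x)^', P t) ->
  \forall y \near x^', cdom phi y /\ P (coord phi y).
Proof.
move=> [ophi _ phiK cphi _] phix nP.
have nd : \forall y \near x, cdom phi y by exact: open_nbhs_nbhs.
have := cphi x phix _ nP => /= nc.
near=> y.
have py : cdom phi y by near: y; exact: nbhs_dnbhs.
split=> //.
have : coord phi y != coord phi x -> P (coord phi y).
  by near: y; exact: nbhs_dnbhs.
apply; apply/eqP => e.
have /eqP : y != x by near: y; exact: nbhs_dnbhs_neq.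
by apply; rewrite -(phiK y) // e phiK.
Unshelve. all: by end_near. Qed.

Lemma derivable_div_pow (g : K -> K) (t0 t : K) (n : nat) :
  t != t0 -> derivable g t 1 ->
  derivable (fun s => g s / (s - t0) ^+ n) t 1.
Proof.
move=> tt0 dg; apply: derivableM => //.
apply: derivableV; first by rewrite expf_neq0 // subr_eq0.
have -> : (fun s => (s - t0) ^+ n) = (id - cst t0) ^+ n :> (K -> K).
  by apply/funext => s; rewrite exprfctE.
by apply: derivableX; apply: derivableB.
Qed.

(** Around each point the given chart shows differentiability at the other
    points nearby; passing to arbitrary charts at these points is
    [derivable_change_chart]. *)
Lemma meromorphic_derivable (f : X -> K) : meromorphic S f ->
  almost_all (fun x => forall phi, atlas S phi -> cdom phi x ->
    derivable (f \o param phi) (coord phi x) 1).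
Proof.
move=> mf; apply: compact_almost_all (crs_compact S) _ => x.
have [phi Aphi phix] := atlas_cover S x.
have [n [g [dg fg]]] := mf phi Aphi x phix.
have : \forall t \near (coord phi x)^', derivable (f \o param phi) t 1.
  have nfg : \forall t \near (coord phi x)^', \forall s \near t,
     f (param phi s) = g s / (s - coord phi x) ^+ n.
    by apply: near_join_dnbhs fg; exact: norm_hausdorff.
  near=> t.
  apply: (@near_eq_derivable _ _ _
    (fun s => g s / (s - coord phi x) ^+ n)).
    by near: t; apply: filterS nfg => t; apply: filterS => s /esym.
  apply: derivable_div_pow; last by near: t; exact: nbhs_dnbhs.
  by near: t; exact: nbhs_dnbhs_neq.
move=> /(chart_dnbhs (atlas_chart Aphi) phix).
apply: filterS => y [phiy dy] psi Apsi psiy.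
exact: derivable_change_chart Aphi Apsi phiy psiy dy.
Unshelve. all: by end_near. Qed.
End Charts.

(** * The differential identity *)

Lemma is_derive_horner (K : numFieldType) (q : {poly K}) (f : K -> K) (t df : K) :
  is_derive t 1 f df ->
  is_derive t 1 (fun s => q.[f s]) ((q^`()).[f t] * df).
Proof.
move=> fd; elim/poly_ind: q => [|q a IH].
  rewrite deriv0 horner0 mul0r.
  have -> : (fun s => (0 : {poly K}).[f s]) = cst 0.
    by apply/funext => s; rewrite horner0.
  exact: is_derive_cst.
have -> : (fun s => (q * 'X + a%:P).[f s]) = (fun s => q.[f s]) * f + cst a.
  by apply/funext => s; rewrite !hornerE.
apply: is_derive_eq.
rewrite derivD derivM derivX derivC !hornerE /= /GRing.scale /=.
ring.
Qed.

(** The relation is a hypothesis at the point [t] alone: the identity follows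
    from the chain rule applied to [r] = [z] - 1/[h] and from solving the
    relation for [h t]. *)
Lemma differential_of_conic (K : numClosedFieldType) (q k2 : {poly K})
    (z h : K -> K) (t : K) :
  let r := fun s => z s - 1 / h s in
  let D := 2 * k2.[r t] / h t + (q^`()).[r t] in
  derivable z t 1 -> derivable h t 1 -> h t != 0 -> q.[r t] != 0 ->
  k2.[r t] * (h t)^-1 ^+ 2 + (q^`()).[r t] * (h t)^-1 + q.[r t] = 0 ->
  h t * derive1 z t =
    - (D / (2 * q.[r t]) * derive1 r t)
    - 1 / 2 * ((q.[r t])^-1 * derive1 (fun s => q.[r s]) t)
    - (h t)^-1 * derive1 h t.
Proof.
move=> r D dz dh h0 q0 E.
have rd : is_derive t 1 r (derive1 z t + (h t)^-2 * derive1 h t).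
  have -> : r = z - (fun s => (h s)^-1).
    by apply/funext => s; rewrite /r div1r.
  apply: is_derive_eq.
    apply: is_deriveB; apply: DeriveDef => //.
    exact: derivableV.
  by rewrite deriveV // !derive1E scaleNr opprK.
have qd := is_derive_horner q rd.
rewrite (derive1E r) (derive1E (fun s => q.[r s])).
rewrite (derive_val (is_derive := rd)) (derive_val (is_derive := qd)) /D.
move: E q0 h0; move: k2.[r t] (q^`()).[r t] q.[r t] (h t) (derive1 z t).
move: (derive1 h t) => h' k Q' Q H z' E Q0 H0.
(* Eliminating k, in place of Q, leaves Q != 0 as a side condition. *)
have -> : k = - (Q + Q' / H) * H ^+ 2.
  apply/eqP; rewrite -subr_eq0; apply/eqP.
  by rewrite -[RHS](mul0r (H ^+ 2)) -E; field.
by field; rewrite H0 Q0.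
Qed.

(** * Exceptional values of z *)

Section Curve.
Context {K : numClosedFieldType} (q : {poly K}) (s1 s2 s3 s4 c d : K)
  (qE : q = 'X^4 - s1 *: 'X^3 + s2 *: 'X^2 - s3 *: 'X + s4%:P)
  (q0 : q != 0)
  (irr : irreducible_poly (cubic q (P1 c) (P2 s1 c d))).

Lemma conic_of_cubic (z h : K) : q.[z] != 0 -> h != 0 ->
  h ^+ 3 - 3 * ((P2 s1 c d).[z] / q.[z]) * h + 2 * ((P1 c).[z] / q.[z]) = 0 ->
  (K2 s1 s2 c d).[z - 1 / h] * h^-1 ^+ 2 + (q^`()).[z - 1 / h] * h^-1
    + q.[z - 1 / h] = 0.
Proof.
move=> qz h0 E; rewrite -(cubic_quadratic _ _ qE) div1r subrK.
transitivity (q.[z] / h ^+ 3 * (h ^+ 3 - 3 * ((P2 s1 c d).[z] / q.[z]) * h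
  + 2 * ((P1 c).[z] / q.[z]))); last by rewrite E mulr0.
by field; rewrite qz h0.
Qed.

(** The last condition excludes, for each root [e] of [q], the only value of
    [z] that can occur together with [z - 1 / h = e] when [K2] does not vanish
    at [e]; when it does, no value of [z] can. *)
Definition regular_value (z : K) := [/\ q.[z] != 0, z != c &
  forall e, root q e -> z != e - (q^`()).[e] / (K2 s1 s2 c d).[e]].

Lemma almost_all_regular_value : almost_all regular_value.
Proof.
have fq := finite_root_set q0.
pose B := [set z | root q z] `|` [set c] `|`
  (fun e => e - (q^`()).[e] / (K2 s1 s2 c d).[e]) @` [set z | root q z].
apply: (@sub_finite_set _ _ B).
  move=> z /= nz; apply: contrapT => nB; apply: nz; split.
  - by apply/negP => qz; apply: nB; left; left.
  - by apply/eqP => zc; apply: nB; left; right.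
  - by move=> e qe; apply/eqP => ze; apply: nB; right; exists e.
by rewrite !finite_setU; split; [split|exact: finite_image].
Qed.

Lemma regular_value_h_neq0 (z h : K) : regular_value z ->
  h ^+ 3 - 3 * ((P2 s1 c d).[z] / q.[z]) * h + 2 * ((P1 c).[z] / q.[z]) = 0 ->
  h != 0.
Proof.
move=> [qz zc _] E; apply: contraNneq zc => h0.
move: E; rewrite h0 expr0n /= mulr0 subr0 add0r /P1 hornerXsubC => /eqP.
by rewrite !mulf_eq0 invr_eq0 pnatr_eq0 (negbTE qz) orbF subr_eq0.
Qed.

Lemma regular_value_q_neq0 (z h : K) : regular_value z ->
  h ^+ 3 - 3 * ((P2 s1 c d).[z] / q.[z]) * h + 2 * ((P1 c).[z] / q.[z]) = 0 ->
  q.[z - 1 / h] != 0.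
Proof.
move=> gz E; have h0 := regular_value_h_neq0 gz E; have [qz _ ze] := gz.
have := conic_of_cubic qz h0 E; set e := z - 1 / h => C.
apply/negP => /eqP qe; have re : root q e by apply/rootP.
have {}C : (K2 s1 s2 c d).[e] * h^-1 = - (q^`()).[e].
  apply/eqP; rewrite -addr_eq0; apply/eqP/(mulIf (invr_neq0 h0)).
  by rewrite mul0r -{}[RHS]C qe; ring.
have k0 : (K2 s1 s2 c d).[e] != 0.
  apply/eqP => k0; have /eqP := K2_deriv_not_both_zero qE q0 irr re k0.
  by apply; move/eqP: C; rewrite k0 mul0r eq_sym oppr_eq0 => /eqP.
have /eqP := ze e re; apply.
have -> : (q^`()).[e] = - ((K2 s1 s2 c d).[e] * h^-1) by rewrite C opprK.
by rewrite /e; field; rewrite k0 h0.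
Qed.
End Curve.

(** * The Abelian integral *)

Unset Implicit Arguments.
Set Strict Implicit.

Theorem corollary1p2 (R : realType) (a b : 'I_2 -> Cplx R)
    (s1 s2 s3 s4 c d : Cplx R)
    (Pi4E : Pi4 a b =
       'X^4 - s1 *: 'X^3 + s2 *: 'X^2 - s3 *: 'X + s4%:P)
    (irr : irreducible_poly (cubic (Pi4 a b) (P1 c) (P2 s1 c d)))
    (X : topologicalType) (S : compact_riemann_surface (Cplx R) X)
    (p : X -> sphere (Cplx R)) (h : X -> Cplx R)
    (p_holo : holomorphic_to_sphere S p)
    (p_cover : branched_covering 3 p)
    (h_mero : meromorphic S h)
    (h_eq : almost_all (fun x =>
       h x ^+ 3
       - 3 * ((P2 s1 c d).[affine (p x)] / (Pi4 a b).[affine (p x)]) * h x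
       + 2 * ((P1 c).[affine (p x)] / (Pi4 a b).[affine (p x)]) = 0)) :
  let z := fun x => affine (p x) in
  let Rf := fun x => z x - 1 / h x in
  let Delta := fun x =>
    2 * (K2 s1 s2 c d).[Rf x] / h x + (deriv (Pi4 a b)).[Rf x] in
  let Pi4R := fun x => (Pi4 a b).[Rf x] in
  [/\ almost_all (fun x => h x != 0),
      almost_all (fun x => Pi4R x != 0) &
      form_eq S
        (form_scale h (dform z))
        (form_sub
          (form_sub
            (form_opp (form_scale (fun x => Delta x / (2 * Pi4R x)) (dform Rf)))
            (form_scale (fun=> 1 / 2) (dln Pi4R)))
          (dln h))].
Proof.
move=> z Rf Delta Pi4R.
have q0 : Pi4 a b != 0.
  rewrite /Pi4; apply/prodf_neq0 => j _.
  by rewrite mulf_neq0 // polyXsubC_eq0.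
have good := almost_all_and
  (branched_covering_almost_all p_cover
    (almost_all_sphere (almost_all_regular_value s1 s2 c d q0))) h_eq.
split.
- apply: almost_all_mono good => x [[v pv gv]]; rewrite pv.
  exact: regular_value_h_neq0 gv.
- apply: almost_all_mono good => x [[v pv gv]]; rewrite /Pi4R /Rf /z pv.
  exact: (regular_value_q_neq0 Pi4E q0 irr gv).
apply: almost_all_mono (almost_all_and good (meromorphic_derivable h_mero)).
move=> x [[[v pv gv] E] dh] phi Aphi phix.
have [_ _ phiK _ _] := atlas_chart Aphi.
have dz : derivable (z \o param phi) (Defs.coord phi x) 1.
  by have := p_holo.2 phi Aphi x phix; rewrite pv.
have zx : z x = v by rewrite /z pv.
move: E; rewrite pv => E.
have hx : h x != 0 by exact: regular_value_h_neq0 gv E.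
rewrite /form_sub /form_opp /form_scale /dln /dform.
have := @differential_of_conic _ (Pi4 a b) (K2 s1 s2 c d) _ _ _ dz
  (dh phi Aphi phix).
rewrite /= phiK //; apply=> //; rewrite zx.
- exact: (regular_value_q_neq0 Pi4E q0 irr gv E).
- by have [qv _ _] := gv; exact: (conic_of_cubic Pi4E qv hx E).
Qed.
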